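(* Let $\kappa$ be an inaccessible cardinal and let $K$ be the unique (up to isomorphism) $\kappa$-existentially closed group of cardinality $\kappa$; it is necessarily a limit of regular representations of length $\kappa$ with countable base, say $K=\bigcup_{\alpha<\kappa}G_\alpha$ with levels $(G_\alpha)_{\alpha<\kappa}$. For $C\subseteq\kappa$ let $Aut_C(K)$ be the group of automorphisms $\varphi$ of $K$ with $\varphi[G_\alpha]=G_\alpha$ for all $\alpha\in C$. Then $$Aut(K)=\bigcup_{\substack{C\subseteq\kappa\\ C\text{ is club}}}Aut_C(K)=\bigcup_{\alpha<\kappa}Aut_{\{\alpha\}}(K).$$
   Context: Inaccessible means uncountable and strongly inaccessible. For an infinite cardinal $\kappa$, a group $G$ with $|G|\ge\kappa$ is $\kappa$-existentially closed if every system of fewer than $\kappa$ many equations and inequations with coefficients in $G$ which has a solution in some supergroup $H\geqslant G$ already has a solution in $G$. A group is the limit of regular representations of length $\kappa$ with base $G_0$ (where $|G_0|\ge 3$ is assumed) if it is the direct limit of the directed system $\{G_\alpha\}_{\alpha<\kappa}$ where $G_{\alpha+1}=Sym(G_\alpha)$ and $G_\alpha\hookrightarrow G_{\alpha+1}$ via its right regular representation for all $\alpha<\kappa$, and $G_\gamma=\varinjlim_{\alpha<\gamma}G_\alpha$ for all limit $\gamma<\kappa$. Each $G_\alpha$ is identified with its image, so that $G_\alpha\leqslant G_\beta$ for $\alpha<\beta$ and the limit group is $\bigcup_{\alpha<\kappa}G_\alpha$. Countable means finite or countably infinite. A club subset of $\kappa$ is a closed and unbounded subset. It is known (earlier work)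 that for inaccessible $\kappa$ a $\kappa$-existentially closed group of cardinality $\kappa$ exists, is unique up to isomorphism, and is such a limit. *)

(* Defs.v *)
From mathcomp Require Import all_boot all_order.
From mathcomp Require Import all_classical.
From mathcomp Require wochoice.

Set Implicit Arguments.
Unset Strict Implicit.
Unset Printing Implicit Defensive.

Import Order.TTheory.
Local Open Scope classical_set_scope.
Local Open Scope card_scope.
Local Open Scope order_scope.

Definition card_lt (T U : Type) (A : set T) (B : set U) : Prop :=
  A #<= B /\ ~ (B #<= A).

(* A cardinal kappa is an initial ordinal, given as a well-ordered type whose
   elements are the ordinals alpha < kappa. *)
Section Ordinals.
Context {d : Order.disp_t} (kappa : orderType d).

Definition is_cardinal : Prop :=
  wochoice.well_order (<=%O : rel kappa) /\
  forall a : kappa, card_lt [set b | b < a] [set: kappa].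

Definition unbounded (C : set kappa) : Prop :=
  forall a, exists2 b, C b & a <= b.

Definition is_regular : Prop :=
  forall C : set kappa, unbounded C -> C #= [set: kappa].

Definition is_strong_limit : Prop :=
  forall A : set kappa,
    card_lt A [set: kappa] -> card_lt [set B | B `<=` A] [set: kappa].

Definition inaccessible : Prop :=
  [/\ is_cardinal, ~ countable [set: kappa], is_regular & is_strong_limit].

Definition is_zero (a : kappa) : Prop := forall b, a <= b.

Definition is_succ (a b : kappa) : Prop :=
  a < b /\ forall c, a < c -> b <= c.

Definition is_limit (a : kappa) : Prop :=
  ~ is_zero a /\ forall b, b < a -> exists2 c, b < c & c < a.

Definition club (C : set kappa) : Prop :=
  unbounded C /\
  forall a, is_limit a ->
    (forall b, b < a -> exists c, [/\ C c, b < c & c < a]) -> C a.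

End Ordinals.

Local Open Scope group_scope.

(* Group words in variables from X with coefficients in G, i.e. expressions for
   the elements of the free product of G and the free group on X. *)
Inductive word (G X : Type) : Type :=
  | Coef of G
  | Var of X
  | Mul of word G X & word G X
  | Inv of word G X.

Inductive condition (G X : Type) : Type :=
  | Equation of word G X & word G X
  | Inequation of word G X & word G X.

Section Systems.
Context (G X : Type) (H : groupType) (i : G -> H).

Fixpoint eval (v : X -> H) (w : word G X) : H :=
  match w with
  | Coef g => i g
  | Var x => v x
  | Mul w1 w2 => eval v w1 * eval v w2
  | Inv w1 => (eval v w1)^-1
  end.

Definition holds (v : X -> H) (c : condition G X) : Prop :=
  match c with
  | Equation w1 w2 => eval v w1 = eval v w2
  | Inequation w1 w2 => eval v w1 <> eval v w2
  end.

Definition solvable_via (S : set (condition G X)) : Prop :=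
  exists v : X -> H, forall c, S c -> holds v c.

End Systems.

(* A supergroup of G is a group H with an embedding i : G -> H. Only the
   cardinality of the type kappa is used. *)
Definition existentially_closed (kappa : Type) (G : groupType) : Prop :=
  [set: kappa] #<= [set: G] /\
  forall (X : Type) (S : set (condition G X)),
    card_lt S [set: kappa] ->
    (exists (H : groupType) (i : G -> H),
      [/\ monoid_morphism i, injective i & solvable_via i S]) ->
    solvable_via (@id G) S.

Section RegularRepresentations.
Context {d : Order.disp_t} {kappa : orderType d} {K : groupType}.

(* The symmetric group on a subset A of K: permutations of A, extended by the
   identity outside A. *)
Definition Sym (A : set K) : set (K -> K) :=
  [set f | set_bij A A f /\ forall x, ~ A x -> f x = x].

Definition right_regular (A : set K) (g : K) : K -> K :=
  patch id A (fun x => x * g).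

(* B, as a group containing A, is Sym(A) with A embedded by its right regular
   representation. Permutations act on the right: f followed by g is g \o f. *)
Definition is_Sym_over (A B : set K) : Prop :=
  exists e : K -> (K -> K),
    [/\ set_bij B (Sym A) e,
        forall x y, B x -> B y -> e (x * y) = e y \o e x
      & forall g, A g -> e g = right_regular A g].

(* K is the union of the increasing chain G of its subgroups, each level being
   identified with its image in K. *)
Definition limit_of_regular_representations
    (G0 : set K) (G : kappa -> set K) : Prop :=
  [/\ [/\ forall a, group_closed (mem (G a)),
          forall a b, a <= b -> G a `<=` G b
        & [set: K] = \bigcup_a G a],
      `I_3 #<= G0,
      forall a, is_zero a -> G a = G0,
      forall a b, is_succ a b -> is_Sym_over (G a) (G b)
    & forall a, is_limit a -> G a = \bigcup_(b in [set b | b < a]) G b].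

End RegularRepresentations.

Definition automorphisms (K : groupType) : set (K -> K) :=
  [set phi | monoid_morphism phi /\ bijective phi].
Arguments automorphisms K : clear implicits.

Definition setwise_automorphisms {d : Order.disp_t} {kappa : orderType d} {K : groupType}
    (G : kappa -> set K) (C : set kappa) : set (K -> K) :=
  [set phi | automorphisms K phi /\ forall a, C a -> phi @` G a = G a].

(* Main.v *)
Require Import Defs.
From HB Require Import structures.
From mathcomp Require Import all_boot all_order.
From mathcomp Require Import all_classical.

(** By transfinite induction every level has fewer than kappa elements: the
    base is countable, successors are handled by the strong limit property and
    limits by regularity. Hence, for an automorphism phi, the images of a level
    under phi and its inverse lie in a later level. The levels fixed by phi
    form a closed set since the chain is continuous, and iterating this step
    omega times above any given ordinal shows that they are unbounded. *)

Set Implicit Arguments.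
Unset Strict Implicit.
Unset Printing Implicit Defensive.

Import Order.TTheory.
Local Open Scope classical_set_scope.
Local Open Scope card_scope.
Local Open Scope order_scope.

Lemma card_le_lt_trans (T U V : Type) (A : set T) (B : set U) (C : set V) :
  A #<= B -> card_lt B C -> card_lt A C.
Proof.
move=> AB [BC nCB]; split; first exact: card_le_trans BC.
by move=> CA; apply: nCB; exact: card_le_trans AB.
Qed.

Lemma card_le_injT (T : Type) (U : choiceType) (u : U) (A : set T) :
  A #<= [set: U] -> exists f : T -> U, {in A &, injective f}.
Proof.
pose P : pointedType := HB.pack (U : Type) (isPointed.Build U u) (Choice.class U).
by move=> /(@pcard_injP T P A).
Qed.

(** * Consequences of well-ordering, regularity and the strong limit property *)

Section InaccessibleCardinal.
Context {d : Order.disp_t} {kappa : orderType d}.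
Hypothesis kappaP : inaccessible kappa.

Lemma inaccessible_inhabited : inhabited kappa.
Proof.
have [_ ncount _ _] := kappaP.
apply: contrapT => ninh; apply: ncount.
suff -> : [set: kappa] = set0 by exact: countable0.
by apply/seteqP; split=> // x _; apply: ninh; exists.
Qed.

Lemma inaccessible_min (P : set kappa) :
  P !=set0 -> exists2 a, P a & forall b, P b -> a <= b.
Proof.
have [[wo _] _ _ _] := kappaP.
move=> [x Px]; have [|a [[Pa amin] _]] := wo [pred x | `[< P x >]].
  by exists x; apply/asboolP.
exists a; first exact/asboolP.
by move=> b Pb; apply: amin; apply/asboolP.
Qed.

Lemma inaccessible_ind (P : kappa -> Prop) :
  (forall a, (forall b, b < a -> P b) -> P a) -> forall a, P a.
Proof.
move=> IH a; apply: contrapT => nPa.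
have [|c nPc cmin] := @inaccessible_min [set a | ~ P a]; first by exists a.
apply: nPc; apply: IH => b bc; apply: contrapT => /cmin.
by rewrite leNgt bc.
Qed.

Lemma zero_succ_or_limit (a : kappa) :
  [\/ is_zero a, exists b, is_succ b a | is_limit a].
Proof.
have [za|nza] := pselect (is_zero a); first by constructor 1.
have [sa|nsa] := pselect (exists b, is_succ b a); first by constructor 2.
constructor 3; split=> // b ba; apply: contrapT => nbetween; apply: nsa.
exists b; split=> // c bc; rewrite leNgt; apply/negP => ca.
by apply: nbetween; exists c.
Qed.

(** Otherwise the image of [A] is unbounded, so by regularity it has size kappa, although it is a
    surjective image of [A]. *)
Lemma small_bounded (T : Type) (A : set T) (g : T -> kappa) :
  card_lt A [set: kappa] -> exists c, forall x, A x -> g x < c.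
Proof.
have [_ _ reg _] := kappaP.
move=> [_ nA]; apply: contrapT => unb; apply: nA.
apply: card_le_trans (card_image_le g A).
rewrite -(card_le_eql (reg (g @` A) _)); first exact: card_lexx.
move=> a; apply: contrapT => nb; apply: unb; exists a => x Ax.
by rewrite ltNge; apply/negP => agx; apply: nb; exists (g x) => //; exists x.
Qed.

(** Initial segments of an initial ordinal are small, and [g] injects [A] into one of them. *)
Lemma bounded_small (T : Type) (A : set T) (g : T -> kappa) (c : kappa) :
  {in A &, injective g} -> (forall x, A x -> g x < c) ->
  card_lt A [set: kappa].
Proof.
have [[_ card] _ _ _] := kappaP.
move=> ginj gc; apply: card_le_lt_trans (card c).
rewrite -(card_le_eql (inj_card_eq ginj)); apply: subset_card_le.
by move=> _ [x Ax <-]; exact: gc.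
Qed.

Lemma nat_small : card_lt [set: nat] [set: kappa].
Proof.
have [_ ncount _ _] := kappaP.
split; last exact: ncount.
by apply/infiniteP => /finite_set_countable.
Qed.

(** The strong limit property speaks of subsets of kappa only, so [A] is first moved into kappa by
    an injection, and its subsets by taking images. *)
Lemma powerset_small (T : Type) (A : set T) :
  card_lt A [set: kappa] -> card_lt [set B | B `<=` A] [set: kappa].
Proof.
have [_ _ _ slim] := kappaP.
move=> Asmall; have [u] := inaccessible_inhabited.
have [f finj] := card_le_injT u Asmall.1.
have fAsmall := card_le_lt_trans (card_image_le f A) Asmall.
apply: card_le_lt_trans (slim _ fAsmall).
have inj : {in [set B | B `<=` A] &, injective (fun B => f @` B)}.
  have sub (B C : set T) : B `<=` A -> C `<=` A -> f @` B = f @` C -> B `<=` C.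
    move=> BA CA BC x Bx; have : (f @` C) (f x) by rewrite -BC; exists x.
    move=> [y Cy] /finj <- //; rewrite inE; [exact: CA|exact: BA].
  move=> B C; rewrite !inE => BA CA BC.
  by apply/seteqP; split; apply: sub.
rewrite -(card_le_eql (inj_card_eq inj)); apply: subset_card_le.
by move=> _ [B BA <-]; apply: image_subset.
Qed.

Lemma Sym_small (K : groupType) (A : set K) :
  card_lt A [set: kappa] -> card_lt (Sym A) [set: kappa].
Proof.
(* Three powersets: an ordered pair is a set of subsets of [A], and a permutation is a set of such
   pairs. *)
move=> /powerset_small /powerset_small /powerset_small.
apply: card_le_lt_trans.
(* The graph of a permutation, with ordered pairs encoded a la Kuratowski. *)
pose graph (f : K -> K) : set (set (set K)) :=
  [set [set [set x]; [set x; f x]] | x in A].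
have graph_inj : {in Sym A &, injective graph}.
  move=> f g; rewrite !inE => -[_ fid] [_ gid] fg; apply/funext => x.
  have [Ax|nAx] := pselect (A x); last by rewrite fid ?gid.
  have : graph g [set [set x]; [set x; f x]] by rewrite -fg; exists x.
  move=> [y Ay pxy].
  have yx : y = x.
    have : [set [set y]; [set y; g y]] [set x] by rewrite pxy; left.
    by case=> E; change ([set x] y); rewrite E //; left.
  subst y.
  (* Comparing the two-element components both ways leaves [f x = g x], or the degenerate case where
     both equal [x]. *)
  have gxP : [set x; f x] (g x).
    have : [set [set x]; [set x; f x]] [set x; g x] by rewrite -pxy; right.
    case=> E; first by left; change ([set x] (g x)); rewrite -E; right.
    by rewrite -E; right.
  have fxP : [set x; g x] (f x).
    have : [set [set x]; [set x; g x]] [set x; f x] by rewrite pxy; right.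
    case=> E; first by left; change ([set x] (f x)); rewrite -E; right.
    by rewrite -E; right.
  by case: gxP => [gx|->//]; case: fxP => [fx|//]; rewrite gx fx.
rewrite -(card_le_eql (inj_card_eq graph_inj)); apply: subset_card_le.
move=> _ [f [[fA _ _] _] <-] _ [x Ax <-] _ [->|->] y.
  by move=> ->.
by case=> ->//; exact: fA.
Qed.

(** The sequence is bounded because kappa is regular and uncountable; its least strict upper bound
    is a limit because [s] increases strictly. *)
Lemma sup_sequence (s : nat -> kappa) :
  (forall n, s n < s n.+1) ->
  exists a, [/\ is_limit a, forall n, s n < a &
                forall b, b < a -> exists n, b < s n].
Proof.
move=> s_incr; have [c sc] := small_bounded s nat_small.
have [|a sa amin] := @inaccessible_min [set a | forall n, s n < a].
  by exists c => n; exact: sc.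
have below b : b < a -> exists n, b < s n.
  move=> ba; apply: contrapT => nb.
  have /amin : forall n, s n < b.
    (* Passing to index [n.+1] turns the weak bound by [b] into a strict one. *)
    move=> n; apply: lt_le_trans (s_incr n) _; rewrite leNgt.
    by apply/negP => bs; apply: nb; exists n.+1.
  by rewrite leNgt ba.
exists a; split=> //; split.
  by move=> /(_ (s 0%N)); rewrite leNgt sa.
by move=> b /below[n bs]; exists (s n).
Qed.

(** * Size of the levels, and the club of levels fixed by a bijection *)

Section Levels.
Context {K : groupType} (G0 : set K) (G : kappa -> set K).
Hypotheses (cardK : [set: K] #= [set: kappa])
  (limitG : limit_of_regular_representations G0 G) (countG0 : countable G0).

Lemma level_small (a : kappa) : card_lt (G a) [set: kappa].
Proof.
have [_ _ G_zero G_succ G_limit] := limitG.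
elim/inaccessible_ind: a => a IH.
have [za|[b sba]|la] := zero_succ_or_limit a.
- by rewrite (G_zero _ za); exact: card_le_lt_trans countG0 nat_small.
- have [e [[eG einj _] _ _]] := G_succ _ _ sba.
  apply: card_le_lt_trans (Sym_small (IH b sba.1)).
  rewrite -(card_le_eql (inj_card_eq einj)); apply: subset_card_le.
  by move=> _ [x Gx <-]; exact: eG.
- rewrite (G_limit _ la).
  (* With [K] injected into kappa, each earlier level [G b] lies below some [c b]. Fewer than kappa
     of these bounds occur, so a single [m] bounds the whole union. *)
  have [f finj] : exists f : K -> kappa, {in [set: K] &, injective f}.
    by apply: (card_le_injT a); rewrite (card_le_eql cardK) card_lexx.
  have /choice[c cP] b : exists c, b < a -> forall x, G b x -> f x < c.
    have [ba|_] := boolP (b < a); last by exists a.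
    by have [c cP] := small_bounded f (IH b ba); exists c.
  have [[_ card] _ _ _] := kappaP.
  have [m mP] := small_bounded c (card a).
  apply: (@bounded_small _ _ f m) => [x y _ _|x [b ba Gbx]].
    by apply: finj; rewrite inE.
  exact: lt_trans (cP b ba x Gbx) (mP b ba).
Qed.

Lemma image_in_level (phi : K -> K) (a : kappa) :
  exists c, phi @` G a `<=` G c /\ a < c.
Proof.
have [[_ G_mono G_cover] _ _ _ _] := limitG.
have /choice[r rP] x : exists b, G b x.
  by have : [set: K] x by []; rewrite G_cover => -[b _ Gbx]; exists b.
have [c cP] := small_bounded (fun x => Order.max a (r (phi x))) (level_small a).
(* A one-point family yields an ordinal strictly above both [a] and [c], without choosing an element
   of [G a]. *)
have [c' c'P] := small_bounded (fun _ : unit => Order.max a c)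
  (card_le_lt_trans (countableP [set: unit]) nat_small).
have := c'P tt I; rewrite gt_max => /andP[ac' cc'].
exists c'; split=> // _ [x Gx <-].
apply: G_mono (rP (phi x)); apply: ltW; apply: le_lt_trans cc'.
by have := cP x Gx; rewrite gt_max => /andP[_ /ltW].
Qed.

(** By continuity every element of [G a] already lies in a fixed level below [a], where both its
    image and its preimage can be found. *)
Lemma limit_level_fixed (phi : K -> K) (a : kappa) :
  is_limit a ->
  (forall b, b < a -> exists c, [/\ phi @` G c = G c, b < c & c < a]) ->
  phi @` G a = G a.
Proof.
have [[_ G_mono _] _ _ _ G_limit] := limitG.
move=> la cof; rewrite (G_limit _ la); apply/seteqP; split.
  move=> _ [x [b /cof[c [fix_c bc ca]] Gx] <-]; exists c => //.
  by rewrite -fix_c; exists x => //; exact: G_mono (ltW bc) _ Gx.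
move=> y [b /cof[c [fix_c bc ca]] Gy].
have : G c y by exact: G_mono (ltW bc) _ Gy.
by rewrite -fix_c => -[x Gx <-]; exists x => //; exists c.
Qed.

Lemma fixed_levels_club (phi : K -> K) :
  bijective phi -> club [set a | phi @` G a = G a].
Proof.
have [[_ G_mono _] _ _ _ G_limit] := limitG.
move=> [psi phiK psiK]; split; last by move=> a; exact: limit_level_fixed.
(* The inverse [psi] is tracked along with [phi], since invariance under both is what upgrades
   inclusion to equality. *)
have /choice[next nextP] a :
    exists c, [/\ a < c, phi @` G a `<=` G c & psi @` G a `<=` G c].
  have [c [phic ac]] := image_in_level phi a.
  have [c' [psic ac']] := image_in_level psi a.
  exists (Order.max c c'); split; first by rewrite lt_max ac.
    by apply: subset_trans phic _; apply: G_mono; rewrite le_max lexx.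
  by apply: subset_trans psic _; apply: G_mono; rewrite le_max lexx orbT.
move=> a0; pose s n := iter n next a0.
have [n|a [la sa below]] := @sup_sequence s; first by have [] := nextP (s n).
exists a; last exact/ltW/(sa 0%N).
(* An element of [G a] appears at some stage [s n], and [f] moves it at most one stage up, still
   below [a]. *)
have closed f : (forall n, f @` G (s n) `<=` G (s n.+1)) ->
    forall x, G a x -> G a (f x).
  move=> fs x; rewrite (G_limit _ la) => -[b /below[n bs] Gx].
  exists (s n.+1); first exact: sa.
  by apply: fs; exists x => //; exact: G_mono (ltW bs) _ Gx.
apply/seteqP; split.
  by move=> _ [x Gx <-]; apply: closed => // n; have [] := nextP (s n).
move=> y Gy; exists (psi y); last exact: psiK.
by apply: closed => // n; have [] := nextP (s n).
Qed.

Lemma automorphisms_club :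
  automorphisms K =
  \bigcup_(C in [set C : set kappa | club C]) setwise_automorphisms G C.
Proof.
apply/seteqP; split=> [phi phiA|phi [C _ []]//].
(* The club depends on [phi]: it is the largest set of levels that could serve. *)
exists [set a | phi @` G a = G a]; last by split.
exact: fixed_levels_club phiA.2.
Qed.

End Levels.
End InaccessibleCardinal.

Theorem corollary11 (d : Order.disp_t) (kappa : orderType d) (K : groupType)
    (G0 : set K) (G : kappa -> set K) :
  inaccessible kappa ->
  existentially_closed kappa K ->
  [set: K] #= [set: kappa] ->
  limit_of_regular_representations G0 G ->
  countable G0 ->
  automorphisms K = \bigcup_(C in [set C : set kappa | club C]) setwise_automorphisms G C /\
  \bigcup_(C in [set C : set kappa | club C]) setwise_automorphisms G C =
    \bigcup_(a in [set: kappa]) setwise_automorphisms G [set a].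
Proof.
move=> kappaP _ cardK limitG countG0.
have autE := automorphisms_club kappaP cardK limitG countG0.
(* A club is nonempty, and any one of its elements gives a fixed level. Conversely, an automorphism
   fixing one level lies in the union over clubs by the first equality. *)
split=> //; apply/seteqP; split=> [phi [C [unbC _] [phiA fixC]]|phi [a _ [phiA _]]].
  have [u] := inaccessible_inhabited kappaP.
  have [a Ca _] := unbC u.
  by exists a => //; split=> // _ ->; exact: fixC.
by rewrite -autE.
Qed.
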